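(* Let $p$ be an odd prime, $q\in\mathbb{C}_p$ with $|q-1|_p<1$, $h\in\mathbb{Z}$, $\zeta\in T_p$ and $x\in\mathbb{Z}_p$. Define the formal power series $F^{(h)}_{q,\zeta}(t,x)=\sum_{n=0}^\infty E^{(h)}_{n,q,\zeta}(x)\frac{t^n}{n!}$. Then $$F^{(h)}_{q^{-1},\zeta^{-1}}(t,1-x)=\zeta q^{h-1}F^{(h)}_{q,\zeta}(-qt,x).$$ Moreover, for all $n\in\mathbb{Z}_+$, $$E^{(h)}_{n,q^{-1},\zeta^{-1}}(1-x)=(-1)^n\zeta q^{n+h-1}E^{(h)}_{n,q,\zeta}(x).$$
   Context: $\mathbb{Z}_p$, $\mathbb{C}_p$ denote the $p$-adic integers and the completion of the algebraic closure of $\mathbb{Q}_p$; $\mathbb{Z}_+=\{0,1,2,\dots\}$. $T_p=\bigcup_{n\ge1}\{\zeta\in\mathbb{C}_p:\zeta^{p^n}=1\}$; for $\zeta\in T_p$ and $y\in\mathbb{Z}_p$, $\zeta^y$ is defined by continuity. For $Q\in\mathbb{C}_p$ with $|Q-1|_p<1$ (this applies to both $Q=q$ and $Q=q^{-1}$), $[x]_Q=\frac{1-Q^x}{1-Q}$, and for uniformly differentiable $f:\mathbb{Z}_p\to\mathbb{C}_p$ the fermionic $p$-adic $Q$-integral is $\int_{\mathbb{Z}_p}f(x)\,d\mu_{-Q}(x)=\lim_{N\to\infty}\frac{1+Q}{1+Q^{p^N}}\sum_{x=0}^{p^N-1}f(x)(-Q)^x$. For $h\in\mathbb{Z}$, $\xi\in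 T_p$, $n\in\mathbb{Z}_+$, the twisted $(h,Q)$-Euler polynomials are $E^{(h)}_{n,Q,\xi}(x)=\int_{\mathbb{Z}_p}[x+y]_Q^n\xi^y Q^{(h-1)y}\,d\mu_{-Q}(y)$. *)

(* Defs.v *)
From HB Require Import structures.
From mathcomp Require Export all_boot all_order all_algebra.
From mathcomp Require Export all_classical all_reals all_analysis.

Set Implicit Arguments.
Unset Strict Implicit.
Unset Printing Implicit Defensive.

Import Order.TTheory GRing.Theory Num.Theory.
Import numFieldNormedType.Exports.

Local Open Scope classical_set_scope.
Local Open Scope ring_scope.

(* The normed structures of the libraries require |n x| = n |x|, which excludes
   ultrametric absolute values; hence the following structure. *)
Record ultrametricField (R : realType) := UltrametricField {
  uf_field : fieldType;
  uf_absv : uf_field -> R;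
  uf_absv_ge0 : forall x, 0 <= uf_absv x;
  uf_absv_eq0 : forall x, (uf_absv x == 0) = (x == 0);
  uf_absvM : forall x y, uf_absv (x * y) = uf_absv x * uf_absv y;
  uf_absv_ultra : forall x y,
    uf_absv (x + y) <= Num.max (uf_absv x) (uf_absv y)
}.

Definition uf_sort (R : realType) (K : ultrametricField R) : Type :=
  GRing.Field.sort (uf_field K).
Coercion uf_sort : ultrametricField >-> Sortclass.

HB.instance Definition _ (R : realType) (K : ultrametricField R) :=
  GRing.Field.on (uf_sort K).

Definition absv (R : realType) (K : ultrametricField R) (x : K) : R :=
  uf_absv x.

Section Metric.
Context {R : realType} (K : ultrametricField R).
Implicit Types x y z : K.

Let dist x y : R := absv (x - y).

Let absv_opp x : absv (- x) = absv x.
Proof.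
have sqr1 : absv (-1 : K) * absv (-1 : K) = absv (1 : K).
  by rewrite /absv -uf_absvM mulrNN mulr1.
have abs1 : absv (1 : K) = 1.
  have nz : absv (1 : K) != 0 by rewrite /absv uf_absv_eq0 oner_eq0.
  by apply: (mulfI nz); rewrite mulr1 /absv -uf_absvM mulr1.
have absN1 : absv (-1 : K) = 1.
  apply/eqP; rewrite -(@eqrXn2 _ 2) ?uf_absv_ge0 ?ler01 //.
  by rewrite expr2 sqr1 abs1 expr1n.
by rewrite -mulN1r /absv uf_absvM -/(absv (-1 : K)) absN1 mul1r.
Qed.

Let distxx x : dist x x = 0.
Proof. by apply/eqP; rewrite /dist subrr /absv uf_absv_eq0. Qed.

Let dist_positivity x y : dist x y = 0 -> x = y.
Proof. by move=> /eqP; rewrite /dist /absv uf_absv_eq0 subr_eq0 => /eqP. Qed.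

Let dist_sym x y : dist x y = dist y x.
Proof. by rewrite /dist -opprB absv_opp. Qed.

Let dist_triangle y x z : dist x z <= dist x y + dist y z.
Proof.
rewrite /dist (_ : x - z = (x - y) + (y - z)); last by rewrite addrA subrK.
apply: (le_trans (uf_absv_ultra _ _)).
by rewrite ge_max lerDl lerDr !uf_absv_ge0.
Qed.

HB.instance Definition _ := isPointed.Build (uf_sort K) 0.
HB.instance Definition _ :=
  isMetric.Build R (uf_sort K) distxx dist_positivity dist_sym dist_triangle.

End Metric.

Section Padic.
Context {R : realType}.
Variables (p : nat) (K : ultrametricField R).
Implicit Types (x y : K).

(* When |p| = 1/p, the closure of the prime field Q in the complete field K is
   the completion of Q for the p-adic absolute value. *)
Definition Qp : set K := closure (range (ratr : rat -> K)).

Definition Zp : set K := [set x | Qp x /\ absv x <= 1].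

(* The elements of K that are algebraic over Q_p. *)
Definition Qpbar : set K :=
  [set x | exists P : {poly K}, [/\ P != 0, forall i, Qp P`_i & root P x]].

(* K is C_p, the completion of an algebraic closure of Q_p: it is complete, with
   |p| = 1/p, and the elements algebraic over Q_p form an algebraically closed
   field (hence an algebraic closure of Q_p) which is dense in K. *)
Record is_Cp : Prop := IsCp {
  Cp_absp : absv (p%:R : K) = p%:R^-1;
  Cp_complete : forall F : set_system K, ProperFilter F -> cauchy F -> cvg F;
  Cp_closed : forall P : {poly K},
    (1 < size P)%N -> (forall i, Qpbar P`_i) ->
    exists2 x : K, Qpbar x & root P x;
  Cp_dense : dense Qpbar
}.

Definition Tp : set K :=
  [set z | exists2 n : nat, (1 <= n)%N & z ^+ (p ^ n) = 1].

(* The natural numbers n tending p-adically to y. *)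
Definition nat_nbhs (y : K) : set_system nat :=
  filter_from (nbhs y) (fun B => [set n : nat | B n%:R]).

(* z^y for y in Z_p, by continuity from the powers z^n, n in N. *)
Definition padic_pow (z y : K) : K := lim (z ^+ n @[n --> nat_nbhs y]).

(* [x]_1 = x is the limit of [x]_Q at Q = 1, where (1 - Q^x) / (1 - Q) is 0/0. *)
Definition qnum (Q x : K) : K :=
  if Q == 1 then x else (1 - padic_pow Q x) / (1 - Q).

(* int_{Z_p} f d mu_{-Q}; meaningful for uniformly differentiable f on Z_p, whose
   values outside Z_p play no role. *)
Definition fermionic_integral (Q : K) (f : K -> K) : K :=
  limn (fun N : nat => (1 + Q) / (1 + Q ^+ (p ^ N)) *
                       \sum_(y < p ^ N) f y%:R * (- Q) ^+ y).

(* E^(h)_{n,Q,xi}(x) = int_{Z_p} [x+y]_Q^n xi^y Q^((h-1)y) d mu_{-Q}(y) *)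
Definition twisted_euler (h : int) (n : nat) (Q xi x : K) : K :=
  fermionic_integral Q (fun y => qnum Q (x + y) ^+ n * padic_pow xi y *
                        padic_pow Q ((h - 1)%:~R * y)).

(* A formal power series in t is the sequence of its coefficients. *)
Definition fps := nat -> K.

Definition fps_scale (c : K) (F : fps) : fps := fun n => c * F n.

(* F(t) |-> F(c t) *)
Definition fps_dilate (c : K) (F : fps) : fps := fun n => c ^+ n * F n.

Definition twisted_eulerF (h : int) (Q xi x : K) : fps :=
  fun n => twisted_euler h n Q xi x / (n`!)%:R.

End Padic.

(* Main.v *)
(* Write P = p^N.  In the partial sums of the integral defining the left-hand
   side, substitute y |-> P - 1 - y.  Since [P - z]_{1/q} differs from
   [-z]_{1/q} = - q [z]_q by a quantity of size |1 - q^P|, uniformly in z in Z_p,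
   and since P is odd, zeta^P = 1 for N large and q^P -> 1, the substituted sum
   differs from (-1)^n zeta q^(n+h-1) times the partial sum of the right-hand
   side by a quantity tending to 0, all the other factors having absolute
   value 1. *)
Require Import Defs.
From mathcomp Require Import ring zify.

Import Order.TTheory GRing.Theory Num.Theory.
Local Open Scope classical_set_scope.
Local Open Scope ring_scope.

(** * Ultrametric absolute values and limits of sequences *)

Section AbsoluteValue.
Context {R : realType} {K : ultrametricField R}.
Implicit Types x y z : K.

Lemma absv_ge0 x : 0 <= absv x. Proof. exact: uf_absv_ge0. Qed.

Lemma absv_eq0 x : (absv x == 0) = (x == 0). Proof. exact: uf_absv_eq0. Qed.

Lemma absv0 : absv (0 : K) = 0. Proof. by apply/eqP; rewrite absv_eq0. Qed.

Lemma absvM x y : absv (x * y) = absv x * absv y.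
Proof. exact: uf_absvM. Qed.

Lemma absv1 : absv (1 : K) = 1.
Proof.
have nz : absv (1 : K) != 0 by rewrite absv_eq0 oner_eq0.
by apply: (mulfI nz); rewrite mulr1 -absvM mulr1.
Qed.

Lemma absvX x n : absv (x ^+ n) = absv x ^+ n.
Proof. by elim: n => [|n IHn]; rewrite ?expr0 ?absv1 // !exprS absvM IHn. Qed.

Lemma absvV x : absv x^-1 = (absv x)^-1.
Proof.
have [->|x0] := eqVneq x 0; first by rewrite invr0 absv0 invr0.
have ax0 : absv x != 0 by rewrite absv_eq0.
by apply: (mulfI ax0); rewrite -absvM !divff // absv1.
Qed.

Lemma absvN x : absv (- x) = absv x.
Proof.
apply/eqP; rewrite -(@eqrXn2 _ 2) ?absv_ge0 //.
by rewrite -!absvX sqrrN.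
Qed.

Lemma absv_distC x y : absv (x - y) = absv (y - x).
Proof. by rewrite -absvN opprB. Qed.

Lemma absvD_le e x y : absv x <= e -> absv y <= e -> absv (x + y) <= e.
Proof.
by move=> xe ye; apply: le_trans (uf_absv_ultra _ _) _; rewrite ge_max xe.
Qed.

Lemma absvD_lt e x y : absv x < e -> absv y < e -> absv (x + y) < e.
Proof.
by move=> xe ye; apply: le_lt_trans (uf_absv_ultra _ _) _; rewrite gt_max xe.
Qed.

Lemma absvB_le e x y : absv x <= e -> absv y <= e -> absv (x - y) <= e.
Proof. by move=> xe ye; apply: absvD_le; rewrite ?absvN. Qed.

Lemma absv_sum_le (I : Type) (r : seq I) (P : pred I) (F : I -> K) e :
  0 <= e -> (forall i, P i -> absv (F i) <= e) ->
  absv (\sum_(i <- r | P i) F i) <= e.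
Proof.
move=> e0 Fe; elim/big_rec: _ => [|i x Pi xe]; first by rewrite absv0.
by apply: absvD_le; rewrite ?Fe.
Qed.

Lemma absv_sum_lt (I : Type) (r : seq I) (P : pred I) (F : I -> K) e :
  0 < e -> (forall i, P i -> absv (F i) < e) ->
  absv (\sum_(i <- r | P i) F i) < e.
Proof.
move=> e0 Fe; elim/big_rec: _ => [|i x Pi xe]; first by rewrite absv0.
by apply: absvD_lt; rewrite ?Fe.
Qed.

(** Were [absv x] below 1, then so would be the absolute value of [1 = x - (x - 1)]. *)
Lemma absv_unit x : absv (x - 1) < 1 -> absv x = 1.
Proof.
move=> x1; apply/eqP; rewrite eq_le; apply/andP; split.
  by rewrite -(subrK 1 x); apply: absvD_le (ltW x1) _; rewrite absv1.
rewrite leNgt; apply/negP => xlt.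
suff : absv (1 : K) < 1 by rewrite absv1 ltxx.
by rewrite -[X in absv X](subKr x); apply: absvD_lt; rewrite ?absvN.
Qed.

Lemma absv_nat (n : nat) : absv (n%:R : K) <= 1.
Proof.
elim: n => [|n IHn]; first by rewrite absv0 ler01.
by rewrite -addn1 natrD; apply: absvD_le; rewrite ?absv1.
Qed.

Lemma absv_int (i : int) : absv (i%:~R : K) <= 1.
Proof.
by case: i => n; rewrite ?NegzE ?mulrNz ?absvN; exact: absv_nat.
Qed.

Lemma absv_expB1 z n : absv z <= 1 -> absv (z ^+ n - 1) <= absv (z - 1).
Proof.
move=> z1; rewrite subrX1 absvM ler_piMr ?absv_ge0 //.
by apply: absv_sum_le => // i _; rewrite absvX exprn_ile1 ?absv_ge0.
Qed.

(** The cofactor of [x - y] is a sum of monomials of degree [n.-1]; [1 <= M] lets the exponent be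
    rounded up to [n]. *)
Lemma absv_expB x y M n : 1 <= M -> absv x <= M -> absv y <= M ->
  absv (x ^+ n - y ^+ n) <= absv (x - y) * M ^+ n.
Proof.
move=> M1 xM yM; have M0 : 0 <= M := le_trans ler01 M1.
rewrite subrXX absvM ler_wpM2l ?absv_ge0 //.
apply: absv_sum_le => [|i _]; first exact: exprn_ge0.
rewrite absvM !absvX; have lt_in := ltn_ord i.
apply: (@le_trans _ _ (M ^+ (n.-1 - i) * M ^+ i)).
  by rewrite ler_pM ?exprn_ge0 ?absv_ge0 // lerXn2r ?nnegrE ?absv_ge0.
by rewrite -exprD ler_weXn2l //; lia.
Qed.

Lemma absv_cvgP {T : Type} (F : set_system T) {FF : Filter F} (f : T -> K) l :
  f @ F --> l <-> forall e, 0 < e -> \forall t \near F, absv (l - f t) < e.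
Proof. exact: cvg_ballP. Qed.

Lemma nbhs_absv x e : 0 < e -> nbhs x [set y | absv (x - y) < e].
Proof. exact: nbhsx_ballx. Qed.

Lemma ultrametric_hausdorff : hausdorff_space K.
Proof. exact: metric_hausdorff. Qed.

(* If one of the sequences diverges, so does the other one, and both limits are
   the default point 0. *)
Lemma limn_proportional (u v : nat -> K) c : c != 0 ->
  (forall e, 0 < e -> \forall n \near \oo, absv (u n - c * v n) < e) ->
  limn u = c * limn v.
Proof.
move=> c0 uv; have ac0 : 0 < absv c by rewrite lt_neqAle eq_sym absv_eq0 c0 absv_ge0.
have vu l : v @ \oo --> l -> u @ \oo --> c * l.
  move=> /absv_cvgP vl; apply/absv_cvgP => e e0.
  near=> n.
  rewrite (_ : c * l - u n = c * (l - v n) - (u n - c * v n)); last by ring.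
  apply: absvD_lt; rewrite ?absvN.
    rewrite absvM mulrC -ltr_pdivlMr //; near: n.
    by apply: vl; exact: divr_gt0.
  by near: n; exact: uv.
have uv' l : u @ \oo --> l -> v @ \oo --> c^-1 * l.
  move=> /absv_cvgP ul; apply/absv_cvgP => e e0.
  have ec0 : 0 < e * absv c by exact: mulr_gt0.
  near=> n.
  rewrite (_ : c^-1 * l - v n = c^-1 * ((l - u n) + (u n - c * v n))); last first.
    by field.
  rewrite absvM absvV mulrC -ltr_pdivlMr ?invr_gt0 // invrK.
  by apply: absvD_lt; near: n; [exact: ul|exact: uv].
have [cv|dv] := pselect (cvgn v).
  by apply/cvg_lim; [exact: ultrametric_hausdorff|exact: vu].
rewrite (dvgP dv) dvgP; first by rewrite [RHS]mulr0.
by move=> /uv' /cvgP.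
Unshelve. all: by end_near. Qed.

End AbsoluteValue.

Lemma expr_small (R : realType) (r e : R) : 0 <= r -> r < 1 -> 0 < e ->
  exists k, r ^+ k < e.
Proof.
move=> r0 r1 e0.
have : `|r| < 1 by rewrite ger0_norm.
move=> /(cvg_geometric 1)/cvgrPdist_lt/(_ _ e0)[k _ /(_ k (leqnn k))].
by rewrite /= sub0r normrN mul1r ger0_norm ?exprn_ge0 //; exists k.
Qed.

(* n |-> z^n is continuous at 0, hence uniformly continuous, on the natural
   numbers with the p-adic topology. *)
Definition padic_cont {R : realType} {K : ultrametricField R} (p : nat)
    (z : K) : Prop :=
  forall e : R, 0 < e ->
    exists k : nat, forall m : nat, (p ^ k %| m)%N -> absv (z ^+ m - 1) < e.

(** * Absolute values of integers and images of rationals in [K] *)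

Section PadicPowers.
Context {R : realType} {p : nat} {K : ultrametricField R}.
Hypotheses (hp : prime p) (absp : absv (p%:R : K) = p%:R^-1).
Implicit Types x y z l : K.

Let p_gt0 : 0 < (p%:R : R). Proof. by rewrite ltr0n prime_gt0. Qed.

Let pV_lt1 : (p%:R^-1 : R) < 1.
Proof. by rewrite invf_lt1 // ltr1n prime_gt1. Qed.

Let pV_ge0 : 0 <= (p%:R^-1 : R). Proof. by rewrite invr_ge0 ltW. Qed.

Let pX_gt0 k : 0 < (p%:R^-1 ^+ k : R). Proof. by rewrite exprn_gt0 // invr_gt0. Qed.

Lemma absv_pX k : absv ((p ^ k)%:R : K) = p%:R^-1 ^+ k.
Proof. by rewrite natrX absvX absp. Qed.

Lemma absv_dvdn k n : (p ^ k %| n)%N -> absv (n%:R : K) <= p%:R^-1 ^+ k.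
Proof.
move=> /dvdnP[m ->]; rewrite natrM absvM absv_pX.
by rewrite ler_piMl ?absv_nat // ltW.
Qed.

(** A Bezout relation [1 = u p - v n] is incompatible with both [p] and [n] having absolute value
    below 1. *)
Lemma absv_coprime n : coprime p n -> absv (n%:R : K) = 1.
Proof.
move=> copn; apply/eqP; rewrite eq_le absv_nat leNgt; apply/negP => nlt.
case: (egcdnP n (prime_gt0 hp)) => u v uv _.
suff : absv (1 : K) < 1 by rewrite absv1 ltxx.
have -> : (1 : K) = (u * p)%:R - (v * n)%:R.
  by rewrite uv (eqP copn) natrD addrAC subrr add0r.
rewrite !natrM; apply: absvD_lt; rewrite ?absvN absvM.
  by apply: le_lt_trans (_ : absv (p%:R : K) < 1); rewrite ?absp // ler_piMl ?absv_nat.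
by apply: le_lt_trans nlt; rewrite ler_piMl ?absv_nat ?absv_ge0.
Qed.

Lemma dvdn_absv k n : absv (n%:R : K) <= p%:R^-1 ^+ k -> (p ^ k %| n)%N.
Proof.
case: (posnP n) => [->|n0]; first by rewrite dvdn0.
have [m copm ->] := pfactor_coprime hp n0; set v := logn p n.
rewrite natrM absvM absv_coprime // mul1r absv_pX.
have [kv|vk] := leqP k v; first by rewrite dvdn_mull ?dvdn_exp2l.
by rewrite leNgt ltr_iXn2l ?invr_gt0 // vk.
Qed.

(** Characteristic 0: if [n] vanished in [K], it would be divisible by [p ^ n], which exceeds it. *)
Lemma natf_neq0 n : (0 < n)%N -> n%:R != 0 :> K.
Proof.
move=> n0; apply/negP => /eqP nE; have := dvdn_absv n n.
rewrite nE absv0 (ltW (pX_gt0 _)) => /(_ isT) /(dvdn_leq n0).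
by rewrite leqNgt ltn_expl ?prime_gt1.
Qed.

Lemma intr_denq_neq0 (a : rat) : (denq a)%:~R != 0 :> K.
Proof.
by rewrite -absz_denq -pmulrn natf_neq0 // absz_gt0 denq_neq0.
Qed.

(** The relation is cleared of denominators, checked between integers inside [rat], then mapped to
    [K], where denominators stay nonzero. *)
Lemma ratr_natB (m : nat) (a : rat) : ratr (m%:R - a) = m%:R - ratr a :> K.
Proof.
set b := m%:R - a.
have da (c : rat) : (denq c)%:~R != 0 :> rat by rewrite intr_eq0 denq_neq0.
have E : numq b * denq a = (m%:Z * denq a - numq a) * denq b.
  apply: (@intr_inj rat); rewrite !intrM intrD mulrNz intrM -pmulrn.
  by rewrite !numqE /b; ring.
move: E => /(congr1 (fun i : int => i%:~R : K)).
rewrite !intrM intrD mulrNz intrM -pmulrn => E.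
rewrite /ratr; apply: (mulIf (intr_denq_neq0 b)).
apply: (mulIf (intr_denq_neq0 a)); rewrite divfK ?intr_denq_neq0 // E.
rewrite mulrAC; congr (_ * _).
by rewrite mulrBl divfK ?intr_denq_neq0.
Qed.

(** * Density of the natural numbers in Z_p, and reflections of Z_p *)

Lemma int_approx (i : int) k :
  exists n : nat, absv (i%:~R - n%:R : K) <= p%:R^-1 ^+ k.
Proof.
have pk0 : (p ^ k)%:Z != 0 by rewrite eqz_nat expn_eq0 negb_and -lt0n prime_gt0.
(* The remainder of [i] modulo [p ^ k] is nonnegative and congruent to [i]. *)
exists `|(i %% (p ^ k)%:Z)%Z|%N.
rewrite [X in absv (_ - X)]pmulrn gez0_abs ?modz_ge0 // {1}(divz_eq i (p ^ k)%:Z).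
rewrite intrD addrK intrM absvM -pmulrn absv_pX.
by rewrite ler_piMl ?absv_int // ltW.
Qed.

(** First [y] is approximated by a rational [a], which is then also of absolute value at most 1;
    such an [a] has a denominator prime to [p], so it is congruent to an integer modulo [p ^ k]. *)
Lemma Zp_approx y k : Zp y -> exists n : nat, absv (y - n%:R) <= p%:R^-1 ^+ k.
Proof.
move=> [yQ y1].
have [_ [[a _ <-] ya]] := yQ _ (nbhs_absv y _ (pX_gt0 k)).
have a1 : absv (ratr a : K) <= 1.
  rewrite -[ratr a](subKr y); apply: absvB_le => //.
  apply: le_trans (ltW ya) _; exact: exprn_ile1 (ltW pV_lt1).
have [n an] : exists n : nat, absv (ratr a - n%:R : K) <= p%:R^-1 ^+ k.
  set d := `|denq a|%N; have d_gt0 : (0 < d)%N by rewrite absz_gt0 denq_neq0.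
  have copnd : coprime `|numq a| d := coprime_num_den a.
  have dE : (denq a)%:~R = d%:R :> K by rewrite pmulrn absz_denq.
  have numE : absv ((numq a)%:~R : K) = absv (`|numq a|%:R : K).
    by rewrite pmulrn; case: (intP (numq a)) => // m; rewrite abszN mulrNz absvN.
  have d0 : d%:R != 0 :> K := natf_neq0 d d_gt0.
  have aE : ratr a * d%:R = (numq a)%:~R :> K by rewrite /ratr dE divfK.
  move: (ratr a) a1 aE ya => r r1 rE _.
  (* If [p] divided [d], the numerator, being prime to [d], would be a unit, although it equals
     [r * d] with [absv r <= 1] and [absv d < 1]. *)
  have copd : coprime p d.
    rewrite prime_coprime //; apply/negP => pd.
    have : absv ((numq a)%:~R : K) = 1.
      rewrite numE absv_coprime // prime_coprime //; apply/negP => pn.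
      have : (p %| gcdn `|numq a| d)%N by rewrite dvdn_gcd pn.
      by rewrite (eqP copnd) dvdn1 => /eqP p1; move: hp; rewrite p1.
    rewrite -rE absvM; apply/eqP; rewrite lt_eqF //.
    apply: le_lt_trans (_ : absv (d%:R : K) < 1).
      by rewrite ler_piMl ?absv_ge0.
    by apply: le_lt_trans pV_lt1; rewrite -[leRHS]expr1 absv_dvdn ?expn1.
  (* Here [u] inverts [d] modulo [p ^ k], so [numq a * u] is an integer close to [r]. *)
  case: (egcdnP (p ^ k) d_gt0) => u v uv _.
  have [n nP] := int_approx (numq a * u%:Z) k.
  exists n; rewrite -(subrK (numq a * u%:Z)%:~R r) -addrA.
  apply: absvD_le => //; rewrite intrM -rE -mulrA -natrM mulnC uv.
  rewrite gcdnC (eqP (coprimeXl k copd)) natrD mulrDr mulr1 opprD addrCA subrr addr0.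
  rewrite absvN absvM natrM !absvM absv_pX.
  rewrite mulrA ler_piMl ?(ltW (pX_gt0 k)) //.
  by rewrite mulr_ile1 ?absv_ge0 ?absv_nat.
exists n; rewrite -(subrK (ratr a) y) -addrA; apply: absvD_le => //; exact: ltW.
Qed.

Lemma Zp_nat n : Zp (n%:R : K).
Proof.
split; last exact: absv_nat.
by apply: subset_closure; exists n%:R; rewrite ?ratr_nat.
Qed.

(** If the rational [a] approximates [y], then [m - a] approximates [m - y] equally well. Negation
    and translation by naturals are deduced from this one case. *)
Lemma Zp_natB m y : Zp y -> Zp (m%:R - y).
Proof.
move=> yZ; split; last by apply: absvB_le (absv_nat _) _; case: yZ.
move=> B /nbhs_ballP[e /= e0 Be].
have [_ [[a _ <-] ya]] := yZ.1 _ (nbhs_absv y _ e0).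
exists (m%:R - ratr a); split.
  by exists (m%:R - a); rewrite ?ratr_natB.
apply: Be; rewrite ballEmdist /=.
rewrite /mdist /=.
change (absv ((m%:R - y) - (m%:R - ratr a)) < e).
by rewrite opprB addrC addrA subrK -absvN opprB.
Qed.

Lemma ZpN y : Zp y -> Zp (- y).
Proof. by move=> /(Zp_natB 0); rewrite sub0r. Qed.

Lemma Zp_Dnat m y : Zp y -> Zp (y + m%:R).
Proof. by move=> /ZpN/(Zp_natB m); rewrite opprK addrC. Qed.

(** * Bases whose powers are p-adically continuous in the exponent *)

Lemma padic_cont_unit z : padic_cont p z -> absv z = 1.
Proof.
move=> /(_ _ ltr01)[k /(_ _ (dvdnn _)) /absv_unit].
rewrite absvX => /eqP; rewrite pexpr_eq1 ?expn_gt0 ?prime_gt0 ?absv_ge0 //.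
by move/eqP.
Qed.

Lemma padic_cont_neq0 z : padic_cont p z -> z != 0.
Proof.
by move=> /padic_cont_unit z1; rewrite -absv_eq0 z1 oner_eq0.
Qed.

Lemma padic_contV z : padic_cont p z -> padic_cont p z^-1.
Proof.
move=> zc e /zc[k km]; exists k => m /km.
have z0 := padic_cont_neq0 z zc.
rewrite -[in absv (_ - 1)]absvN opprB => /(le_lt_trans _); apply.
have -> : z^-1 ^+ m - 1 = z^-1 ^+ m * (1 - z ^+ m).
  by rewrite mulrBr mulr1 -exprMn mulVf // expr1n.
by rewrite absvM absvX absvV padic_cont_unit // invr1 expr1n mul1r.
Qed.

(** Uniform continuity follows from continuity at 0, since [z ^+ m - z ^+ n] is the unit [z ^+ n]
    times [z ^+ (m - n) - 1]. *)
Lemma padic_cont_expB z e : padic_cont p z -> 0 < e ->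
  exists k, forall m n, absv (m%:R - n%:R : K) <= p%:R^-1 ^+ k ->
    absv (z ^+ m - z ^+ n) < e.
Proof.
move=> zc /zc[k kz]; exists k => m n.
wlog nm : m n / (n <= m)%N.
  move=> W; case/orP: (leq_total n m) => [/W//|/W mn].
  by rewrite absv_distC [absv (_ - _ ^+ _)]absv_distC.
rewrite -natrB // => /dvdn_absv /kz kmn.
rewrite -[in z ^+ m - _](subnK nm) exprD -[X in _ - X]mul1r -mulrBl absvM.
by rewrite [absv (_ ^+ n)]absvX (padic_cont_unit z) // expr1n mulr1.
Qed.

Lemma padic_cont_Tp z : Tp p z -> padic_cont p z.
Proof.
move=> [k _ zk] e e0; exists k => m /dvdnP[v ->].
by rewrite mulnC exprM zk expr1n subrr absv0.
Qed.

(** The cofactor of [z - 1] is [p] plus the sum of the [z ^+ i - 1]. Raising to the power [p] thus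
    contracts the distance to 1. *)
Lemma absv_expp_sub1 z : absv (z - 1) < 1 ->
  absv (z ^+ p - 1) <= absv (z - 1) * Num.max p%:R^-1 (absv (z - 1)).
Proof.
move=> z1; rewrite subrX1 absvM ler_wpM2l ?absv_ge0 //.
have -> : \sum_(i < p) z ^+ i = \sum_(i < p) (z ^+ i - 1) + p%:R.
  by rewrite sumrB big_const_ord iter_addr_0 subrK.
apply: absvD_le; last by rewrite absp le_max lexx.
apply: absv_sum_le => [|i _]; first by rewrite le_max pV_ge0.
by rewrite le_max absv_expB1 ?orbT // absv_unit.
Qed.

Lemma padic_cont_near1 z : absv (z - 1) < 1 -> padic_cont p z.
Proof.
move=> z1 e e0; set r := Num.max p%:R^-1 (absv (z - 1)).
have r0 : 0 <= r by rewrite le_max pV_ge0.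
have r1 : r < 1 by rewrite gt_max pV_lt1.
have [k rk] := expr_small _ _ _ r0 r1 e0; exists k => m.
(* The contraction is iterated with the fixed ratio [r]: the successive powers are never farther
   from 1 than [z]. *)
have zk : absv (z ^+ (p ^ k) - 1) <= r ^+ k * absv (z - 1).
  elim: k {rk} => [|k IHk]; first by rewrite mul1r.
  have zr : absv (z ^+ (p ^ k) - 1) <= absv (z - 1).
    by rewrite absv_expB1 // absv_unit.
  rewrite expnSr exprM.
  apply: le_trans (absv_expp_sub1 _ (le_lt_trans zr z1)) _.
  rewrite exprSr mulrAC; apply: ler_pM => //; first exact: absv_ge0.
    by rewrite le_max pV_ge0.
  by rewrite ge_max /r !le_max lexx zr orbT.
move=> /dvdnP[v ->]; rewrite mulnC exprM.
apply: le_lt_trans (absv_expB1 _ _ _) _; first by rewrite absvX absv_unit ?expr1n.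
apply: le_lt_trans zk (le_lt_trans _ rk).
by rewrite ler_piMr ?exprn_ge0 // ltW.
Qed.

(** * Powers with exponents in Z_p *)

Lemma nat_nbhs_absv y (e : R) : 0 < e ->
  \forall n \near nat_nbhs y, absv (y - n%:R) < e.
Proof. by move=> e0; exists [set x | absv (y - x) < e] => //; exact: nbhs_absv. Qed.

Lemma nat_nbhs_proper y : Zp y -> ProperFilter (nat_nbhs y).
Proof.
move=> yZ; apply: filter_from_proper.
  apply: filter_from_filter; first by exists setT; exact: filterT.
  move=> A B yA yB; exists (A `&` B); first exact: filterI.
  by [].
move=> B /nbhs_ballP[e /= e0 Be].
have [k ke] := expr_small _ _ _ pV_ge0 pV_lt1 e0.
have [n yn] := Zp_approx y k yZ; exists n; apply: Be.
by rewrite ballEmdist; exact: le_lt_trans yn ke.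
Qed.

Hypothesis complete : forall F : set_system K, ProperFilter F -> cauchy F -> cvg F.

(** By uniform continuity the powers form a Cauchy filter, with balls centred at [z ^+ m] for
    naturals [m] close to [y]; completeness gives the limit. *)
Lemma padic_pow_cvg z y : padic_cont p z -> Zp y ->
  z ^+ n @[n --> nat_nbhs y] --> padic_pow z y.
Proof.
move=> zc yZ; have Fy := nat_nbhs_proper y yZ.
apply: complete; apply: cauchy_exP => e e0.
have [k kz] := padic_cont_expB z e zc e0.
have [m ym] := Zp_approx y k yZ.
exists (z ^+ m); rewrite /nbhs /=.
near=> n.
rewrite ballEmdist /=; apply: kz.
rewrite -(subrK y m%:R) -addrA; apply: absvD_le; first by rewrite absv_distC.
by apply: ltW; near: n; exact: nat_nbhs_absv.
Unshelve. all: by end_near. Qed.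

Lemma padic_pow_near z y e : padic_cont p z -> Zp y -> 0 < e ->
  exists k, forall n, absv (y - n%:R) <= p%:R^-1 ^+ k ->
    absv (padic_pow z y - z ^+ n) < e.
Proof.
move=> zc yZ e0; have Fy := nat_nbhs_proper y yZ.
have [k kz] := padic_cont_expB z e zc e0; exists k => n yn.
have /absv_cvgP/(_ _ e0) ze := padic_pow_cvg z y zc yZ.
have yk := nat_nbhs_absv y _ (pX_gt0 k).
have [m [/= zm ym]] := filter_ex (filterI ze yk).
rewrite -(subrK (z ^+ m) (padic_pow z y)) -addrA; apply: absvD_lt => //.
apply: kz; rewrite -(subrK y m%:R) -addrA; apply: absvD_le => //.
by rewrite absv_distC ltW.
Qed.

Lemma absv_padic_pow z y : padic_cont p z -> Zp y -> absv (padic_pow z y) <= 1.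
Proof.
move=> zc yZ; have [k kz] := padic_pow_near z y 1 zc yZ ltr01.
have [n yn] := Zp_approx y k yZ.
rewrite -(subrK (z ^+ n) (padic_pow z y)); apply: absvD_le (ltW (kz _ yn)) _.
by rewrite absvX padic_cont_unit // expr1n.
Qed.

Lemma padic_pow_eq z y l : Zp y ->
  (forall e, 0 < e -> exists k, forall n, absv (y - n%:R) <= p%:R^-1 ^+ k ->
    absv (l - z ^+ n) < e) ->
  padic_pow z y = l.
Proof.
move=> yZ zl; have Fy := nat_nbhs_proper y yZ.
apply: cvg_lim; first exact: ultrametric_hausdorff.
apply/absv_cvgP => e /zl[k kl]; near=> n; apply: kl; apply: ltW.
by near: n; exact: nat_nbhs_absv.
Unshelve. all: by end_near. Qed.

Lemma padic_pow_nat z m : padic_cont p z -> padic_pow z m%:R = z ^+ m.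
Proof.
move=> zc; apply: padic_pow_eq (Zp_nat m) _ => e e0.
have [k kz] := padic_cont_expB z e zc e0.
by exists k => n; exact: kz.
Qed.

(** If [i] is close to [y] and [n] to [m - y], then [i + n] is close to [m], so [z ^+ (i + n)] is
    close to [z ^+ m]. *)
Lemma padic_powV_natB z m y : padic_cont p z -> Zp y ->
  padic_pow z^-1 (m%:R - y) = z ^- m * padic_pow z y.
Proof.
move=> zc yZ; apply: padic_pow_eq (Zp_natB m y yZ) _ => e e0.
have z0 := padic_cont_neq0 z zc; have z1 := padic_cont_unit z zc.
have [k kz] := padic_cont_expB z e zc e0.
have [j jz] := padic_pow_near z y e zc yZ e0.
have [i yi] := Zp_approx y (maxn j k) yZ.
have le_pX a b : (a <= b)%N -> p%:R^-1 ^+ b <= p%:R^-1 ^+ a :> R.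
  by move=> ab; rewrite ler_wiXn2l // ltW.
exists k => n yn.
have -> : z ^- m * padic_pow z y - z^-1 ^+ n =
    z ^- m * (padic_pow z y - z ^+ i) + z ^- (m + n) * (z ^+ (i + n) - z ^+ m).
  by rewrite exprVn !exprD; field; rewrite !expf_neq0.
apply: absvD_lt; rewrite absvM absvV absvX z1 expr1n invr1 mul1r.
  by apply: jz; apply: le_trans yi _; rewrite le_pX ?leq_maxl.
apply: kz; rewrite natrD.
rewrite (_ : i%:R + n%:R - m%:R = - ((y - i%:R) + (m%:R - y - n%:R))); last by ring.
rewrite absvN; apply: absvD_le => //.
by apply: le_trans yi _; rewrite le_pX ?leq_maxr.
Qed.

Lemma padic_pow_int z (i : int) : padic_cont p z -> padic_pow z i%:~R = z ^ i.
Proof.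
move=> zc; case: i => m; first by rewrite -pmulrn padic_pow_nat.
(* A negative exponent is written as [0 - m.+1] and the base as the inverse of [z^-1], which is the
   reflection formula at 0. *)
rewrite NegzE mulrNz -pmulrn -[- _]sub0r -{1}[z]invrK.
rewrite (padic_powV_natB _ 0) ?padic_pow_nat //; last 3 first.
- exact: padic_contV.
- exact: padic_contV.
- exact: Zp_nat.
by rewrite invr1 mul1r exprVn exprnN.
Qed.

End PadicPowers.

(** * Reflection of q-numbers and of the partial sums of the integral *)

Section Reflection.
Context {R : realType} {p : nat} {K : ultrametricField R}.
Hypotheses (hp : prime p) (hodd : odd p) (hK : is_Cp p K).
Implicit Types Q q z xi x y : K.

Let absp : absv (p%:R : K) = p%:R^-1. Proof. exact: Cp_absp hK. Qed.
Let complete := Cp_complete hK.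

Lemma absv_qnum_le Q z : padic_cont p Q -> Zp z ->
  absv (qnum Q z) <= Num.max 1 (absv (1 - Q))^-1.
Proof.
move=> Qc zZ; rewrite /qnum le_max; case: eqP => _; first by rewrite zZ.2.
rewrite absvM absvV ler_piMl ?orbT // ?invr_ge0 ?absv_ge0 //.
apply: absvB_le; rewrite ?absv1 //.
exact: (absv_padic_pow hp absp complete).
Qed.

Lemma qnum_reflect_near q e : padic_cont p q -> 0 < e ->
  exists k, forall m z, (p ^ k %| m)%N -> Zp z ->
    absv (qnum q^-1 (m%:R - z) - (- q) * qnum q z) < e.
Proof.
move=> qc e0; have q0 := padic_cont_neq0 hp q qc; have q1 := padic_cont_unit hp q qc.
(* At [q = 1] the difference is exactly [m], whatever [z] is. *)
have [qE|qN1] := eqVneq q 1.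
  have pV0 : 0 <= p%:R^-1 :> R by rewrite invr_ge0.
  have pV1 : p%:R^-1 < 1 :> R by rewrite invf_lt1 ?ltr1n ?ltr0n ?prime_gt0 ?prime_gt1.
  have [k ke] := expr_small _ _ _ pV0 pV1 e0; exists k => m z km zZ.
  rewrite /qnum qE invr1 eqxx mulN1r opprK subrK.
  by apply: le_lt_trans ke; exact: absv_dvdn.
have d0 : 0 < absv (1 - q^-1).
  rewrite lt_neqAle absv_ge0 eq_sym absv_eq0 subr_eq0 eq_sym andbT.
  by rewrite -(inj_eq invr_inj) invrK invr1.
(* The tolerance is scaled by the absolute value of the fixed denominator [1 - q^-1]; as [w] below
   has absolute value at most 1, [k] is independent of [z]. *)
have [k kq] := padic_contV hp q qc _ (mulr_gt0 e0 d0); exists k => m z km zZ.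
rewrite /qnum (negPf qN1) -{1}invr1 (inj_eq invr_inj) (negPf qN1).
rewrite (padic_powV_natB hp absp complete) //; set w := padic_pow q z.
have w1 : absv w <= 1 by exact: (absv_padic_pow hp absp complete).
have -> : (1 - q ^- m * w) / (1 - q^-1) - - q * ((1 - w) / (1 - q)) =
    - (w * (q^-1 ^+ m - 1)) / (1 - q^-1).
  have qB1 : q - 1 != 0 by rewrite subr_eq0.
  have qB1' : 1 - q != 0 by rewrite -opprB oppr_eq0.
  by rewrite -exprVn; field; rewrite ?q0 ?qB1.
rewrite absvM absvV absvN absvM ltr_pdivrMr //.
apply: le_lt_trans (kq _ km).
by rewrite ler_piMl ?absv_ge0.
Qed.

Lemma absv_invB1 z : absv (z - 1) < 1 -> absv (z^-1 - 1) < 1.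
Proof.
move=> z1; have zu := absv_unit _ z1.
have z0 : z != 0 by rewrite -absv_eq0 zu oner_eq0.
have -> : z^-1 - 1 = - (z^-1 * (z - 1)) by field.
by rewrite absvN absvM absvV zu invr1 mul1r.
Qed.

Lemma absv_exprzB1 z (i : int) : absv (z - 1) < 1 -> absv (z ^ i - 1) < 1.
Proof.
move=> z1; have zu := absv_unit _ z1; have expn m : absv (z ^+ m - 1) < 1.
  by apply: le_lt_trans z1; rewrite absv_expB1 // zu.
by case: i => m; [exact: expn|rewrite NegzE -exprnN; exact: absv_invB1].
Qed.

(** At a natural [y] the factors xi^y, Q^((h-1)y) and (-Q)^y merge into one power of [rho]; passing
    to inverse parameters then just inverts [rho]. *)
Definition euler_sum n Q rho x (N : nat) : K :=
  (1 + Q) / (1 + Q ^+ (p ^ N)) *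
    \sum_(y < p ^ N) qnum Q (x + y%:R) ^+ n * rho ^+ y.

Lemma twisted_euler_limE h n Q xi x : padic_cont p Q -> padic_cont p xi ->
  twisted_euler p h n Q xi x =
    limn (euler_sum n Q (xi * Q ^ (h - 1) * - Q) x).
Proof.
move=> Qc xic; rewrite /twisted_euler /fermionic_integral.
congr (limn _); apply/funext => N; congr (_ * _); apply: eq_bigr => y _.
rewrite (padic_pow_nat hp absp) // pmulrn -intrM (padic_pow_int hp absp) //.
by rewrite -exprz_exp -!mulrA !exprMn.
Qed.

(** Since [p] is odd, 2 is a unit, and [(1 + z) / 2] is as close to 1 as [z] is. *)
Lemma absv_1D z : absv (z - 1) < 1 -> absv (1 + z) = 1.
Proof.
move=> z1; have a2 : absv (2%:R : K) = 1.
  by rewrite (absv_coprime hp absp) // coprime_sym prime_coprime // dvdn2 negbK.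
have nz : 2%:R != 0 :> K by rewrite -absv_eq0 a2 oner_eq0.
rewrite -[1 + z](divfK nz) absvM a2 mulr1; apply: absv_unit.
have -> : (1 + z) / 2%:R - 1 = (z - 1) / 2%:R by field.
by rewrite absvM absvV a2 invr1 mulr1.
Qed.

(** With P = p^N, this is an exact identity: q^P / q comes from inverting [q] in the prefactor, and
    rho^(-P) rho from the exponent P - 1 - y of [rho^-1]. *)
Lemma euler_sum_reflect n q rho x N : q != 0 -> rho != 0 -> 1 + q ^+ (p ^ N) != 0 ->
  euler_sum n q^-1 rho^-1 (1 - x) N =
  (1 + q) / (1 + q ^+ (p ^ N)) *
    \sum_(y < p ^ N) (q ^+ (p ^ N) * q^-1 * rho ^- (p ^ N) * rho) *
       (qnum q^-1 ((p ^ N)%:R - (x + y%:R)) ^+ n * rho ^+ y).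
Proof.
move=> q0 rho0 qN; set P := (p ^ N)%N in qN *.
rewrite /euler_sum (reindex_inj rev_ord_inj) /= -/P -!big_distrr /=.
have -> : (1 + q^-1) / (1 + q^-1 ^+ P) = (1 + q) / (1 + q ^+ P) * (q ^+ P * q^-1).
  have qP : q ^+ P != 0 by rewrite expf_neq0.
  rewrite exprVn; field.
  by rewrite ?q0 ?qP ?[_ + 1]addrC ?qN.
rewrite -!mulrA; congr (_ * (_ * _)); do 2!congr (_ * _).
rewrite !big_distrr /=; apply: eq_bigr => y _.
have yP := ltn_ord y.
(* The 1 in [1 - x] absorbs the off-by-one of the reversed index. *)
have -> : 1 - x + (P - y.+1)%:R = P%:R - (x + y%:R).
  by rewrite natrB // -(addn1 y) natrD; ring.
move: (qnum _ _ ^+ n) => a.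
have -> : rho ^+ P = rho ^+ (P - y.+1) * rho * rho ^+ y.
  by rewrite -exprSr -exprD; congr (_ ^+ _); lia.
rewrite exprVn; field.
by rewrite rho0 !expf_neq0.
Qed.

End Reflection.

Theorem theorem2 (R : realType) (p : nat) (hp : prime p) (hodd : odd p)
    (K : ultrametricField R) (hK : is_Cp p K)
    (q : K) (hq : absv (q - 1) < 1) (h : int)
    (zeta : K) (hzeta : Tp p zeta) (x : K) (hx : Zp x) :
  twisted_eulerF p h q^-1 zeta^-1 (1 - x) =
    fps_scale (zeta * q ^ (h - 1)) (fps_dilate (- q) (twisted_eulerF p h q zeta x))
  /\
  forall n : nat,
    twisted_euler p h n q^-1 zeta^-1 (1 - x) =
      (-1) ^+ n * zeta * q ^ (n%:Z + h - 1) * twisted_euler p h n q zeta x.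
Proof.
have main n : twisted_euler p h n q^-1 zeta^-1 (1 - x) =
    (-1) ^+ n * zeta * q ^ (n%:Z + h - 1) * twisted_euler p h n q zeta x.
  have zc := padic_cont_Tp zeta hzeta; have zc' := padic_contV hp zeta zc.
  have qc := padic_cont_near1 hp (Cp_absp hK) q hq; have qc' := padic_contV hp q qc.
  have q0 := padic_cont_neq0 hp q qc; have zeta0 := padic_cont_neq0 hp zeta zc.
  have q1 := padic_cont_unit hp q qc; have zeta1 := padic_cont_unit hp zeta zc.
  set g := q ^ (h - 1); have gB1 : absv (g - 1) < 1 by exact: absv_exprzB1.
  have g0 : g != 0 by exact: expfz_neq0.
  have g1 := absv_unit _ gB1.
  have gc := padic_cont_near1 hp (Cp_absp hK) _ (absv_invB1 _ gB1).
  set rho := zeta * g * - q.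
  have rho0 : rho != 0 by rewrite !mulf_neq0 ?oppr_eq0.
  rewrite (twisted_euler_limE hp hK) // (twisted_euler_limE hp hK) //.
  rewrite -/g -/rho.
  have -> : zeta^-1 * q^-1 ^ (h - 1) * - q^-1 = rho^-1.
    by rewrite exprz_inv -invr_expz -/g /rho !invfM invrN.
  have -> : (-1) ^+ n * zeta * q ^ (n%:Z + h - 1) = zeta * g * (- q) ^+ n.
    rewrite -addrA expfzDr // -exprnP [(- q) ^+ n]exprNn -/g; ring.
  apply: limn_proportional; first by rewrite !mulf_neq0 ?expf_neq0 ?oppr_eq0.
  move=> e e0.
  (* A common bound for the q-numbers in base [q] and in base [q^-1]; each error below is multiplied
     by at most [M ^+ n], hence the tolerance [e / M ^+ n]. *)
  set M := Num.max (Num.max 1 (absv (1 - q))^-1) (Num.max 1 (absv (1 - q^-1))^-1).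
  have M1 : 1 <= M by rewrite !le_max lexx.
  have Mn0 : 0 < M ^+ n by rewrite exprn_gt0 // (lt_le_trans ltr01).
  have eM0 : 0 < e / M ^+ n by exact: divr_gt0.
  have [k1 zk] : exists k, forall m, (p ^ k %| m)%N -> zeta ^+ m = 1.
    case: hzeta => k _ zk; exists k => m /dvdnP[v ->].
    by rewrite mulnC exprM zk expr1n.
  have [k2 gk] := gc _ eM0.
  have [k3 qk] := qnum_reflect_near hp hK q _ qc eM0.
  exists (maxn k1 (maxn k2 k3)) => // N /=; rewrite !geq_max => /and3P[N1 N2 N3].
  have {}zk := zk _ (dvdn_exp2l p N1).
  have {}gk := gk _ (dvdn_exp2l p N2).
  have {}qk z := qk _ z (dvdn_exp2l p N3).
  have qP1 : absv (1 + q ^+ (p ^ N)) = 1.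
    by apply: (absv_1D hp hodd hK); rewrite (le_lt_trans _ hq) ?absv_expB1 ?q1.
  rewrite euler_sum_reflect //; last by rewrite -absv_eq0 qP1 oner_eq0.
  (* Both sides now share the prefactor, a quotient of units. *)
  rewrite /euler_sum [X in _ - X]mulrCA -mulrBr big_distrr /= -sumrB absvM absvM absvV qP1.
  rewrite (absv_1D hp hodd hK q hq) invr1 !mul1r.
  have oddP : odd (p ^ N) by rewrite oddX hodd orbT.
  (* The powers of [q] cancel exactly, and the sign of [rho ^+ (p ^ N)] cancels that of [- q] in
     [rho]; only a power of [g^-1] close to 1 is left. *)
  have -> : q ^+ (p ^ N) * q^-1 * rho ^- (p ^ N) * rho = zeta * g * g^-1 ^+ (p ^ N).
    have -> : rho ^+ (p ^ N) = - (g ^+ (p ^ N) * q ^+ (p ^ N)).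
      by rewrite !exprMn zk [(- q) ^+ _]exprNn -signr_odd oddP; ring.
    rewrite /rho exprVn; field.
    by rewrite q0 oppr_eq0 mulf_neq0 ?expf_neq0.
  (* By the ultrametric inequality a bound on each term suffices, however many terms there are. *)
  apply: absv_sum_lt => // y _.
  have xyZ : Zp (x + y%:R) := Zp_Dnat hp (Cp_absp hK) y x hx.
  have := qk _ xyZ; have := absv_qnum_le hp hK _ _ qc xyZ.
  have := absv_qnum_le hp hK _ _ qc' (Zp_natB hp (Cp_absp hK) (p ^ N) _ xyZ).
  set a := qnum q^-1 _; set b := qnum q _ => aM bM ab.
  have {}aM : absv a <= M by rewrite le_max aM orbT.
  have {}bM : absv (- q * b) <= M by rewrite absvM absvN q1 mul1r le_max bM.
  (* Up to a unit, the error splits into that of the constant and that of the reflected q-number. *)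
  have -> : zeta * g * g^-1 ^+ (p ^ N) * (a ^+ n * rho ^+ y) -
      zeta * g * (- q) ^+ n * (b ^+ n * rho ^+ y) =
      zeta * g * rho ^+ y *
        ((g^-1 ^+ (p ^ N) - 1) * a ^+ n + (a ^+ n - (- q * b) ^+ n)).
    rewrite [(- q * b) ^+ n]exprMn.
    by move: (a ^+ n) (b ^+ n) ((- q) ^+ n) (rho ^+ y) (g^-1 ^+ _) => *; ring.
  have rho1 : absv rho = 1 by rewrite !absvM absvN q1 g1 zeta1 !mulr1.
  rewrite absvM !absvM absvX rho1 expr1n zeta1 g1 !mul1r.
  apply: absvD_lt.
    rewrite absvM absvX.
    apply: (@le_lt_trans _ _ (absv (g^-1 ^+ (p ^ N) - 1) * M ^+ n)); last first.
      by rewrite -ltr_pdivlMr.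
    by rewrite ler_wpM2l ?absv_ge0 // lerXn2r ?nnegrE ?absv_ge0 // (le_trans ler01).
  apply: le_lt_trans (absv_expB _ _ M n M1 aM bM) _.
  by rewrite -ltr_pdivlMr.
(* The series identity is [main] read coefficient by coefficient. *)
split=> //; apply/funext => n.
rewrite /fps_scale /fps_dilate /twisted_eulerF main.
have q0 : q != 0 by rewrite -absv_eq0 (absv_unit _ hq) oner_eq0.
rewrite -addrA expfzDr // -exprnP [(- q) ^+ n]exprNn; ring.
Qed.
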